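(* Let $H$ be a nonnegative weighted graph of even order $n\ge 4$ with weighted adjacency matrix $B_H$, let $s=\sum_{u<v}(B_H)_{uv}$ and $N=n+1$. Suppose all vertices of $H$ have the same weighted degree. For real $M>s$, let $W_M(H)$ be the weighted cone over $H$ with cone weight $M$, and set $T=T(M)=\frac{4Mn^2-4s}{N}$. Then for every $M>s$, $$\frac{N\,a(B_H)}{4(M+s)}\le\Phi(W_M(H))-T\le\frac{N\,a(B_H)}{4(M-s)}.$$ For a fixed such $H$, $$\lim_{M\to\infty}M\bigl(\Phi(W_M(H))-T\bigr)=\frac{N}{4}a(B_H).$$
   Context: A nonnegative weighted graph is a pair $(V,w)$ with $V$ a finite set and $w:\binom{V}{2}\to[0,\infty)$; its weighted adjacency matrix $W=(w_{uv})$ is symmetric with zero diagonal. Its order is $|V|$, and the weighted degree of a vertex $u$ is $\sum_v w_{uv}$. For a weighted adjacency matrix $W$ of order $N$, a labeling is a bijection $\pi:\mathbb{Z}_N\to V$, and $W_\pi$ is the matrix indexed by $\mathbb{Z}_N$ with entries $W_\pi(x,y)=w_{\pi(x)\pi(y)}$. Let $F_N(r,x)=\frac{1}{\sqrt N}e^{-2\pi i rx/N}$ for $r,x\in\mathbb{Z}_N$. For a matrix $C$, $\|C\|_1=\sum_{r,v}|C_{rv}|$ and $\|C\|_2=(\sum_{r,v}|C_{rv}|^2)^{1/2}$. Define $\Phi(W)=\min_\pi\|F_NW_\pi F_N\|_1$, the minimum over all labelings. The weighted cone $W_M(H)$ is the weighted graph of order $N=n+1$ obtained from $H$ by adjoining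 one new vertex $c$ and giving every edge from $c$ to a vertex of $H$ weight $M$ (weights inside $H$ are unchanged); the same symbol denotes its weighted adjacency matrix. Let $\mathcal I_n$ be the set of fixed-point-free involutions of the vertex set of $H$ (permutations $\tau$ with $\tau^2=\mathrm{id}$ and $\tau(v)\ne v$ for all $v$), and let $P_\tau$ be the permutation matrix of $\tau$. Define $a(B_H)=\min_{\tau\in\mathcal I_n}\frac14\|B_H-P_\tau B_HP_\tau\|_2^2$. *)

(* Defs.v *)
From HB Require Import structures.
From mathcomp Require Import all_boot all_order all_algebra all_fingroup.
From mathcomp Require Import complex.
From mathcomp Require Import all_classical all_reals all_analysis.

Set Implicit Arguments.
Unset Strict Implicit.
Unset Printing Implicit Defensive.

Import Order.TTheory GRing.Theory Num.Theory.
Import numFieldNormedType.Exports.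

Local Open Scope ring_scope.

(* The minimum of F over {x | P x}; the value 0 is junk, used only when this
   set is empty. *)
Definition fmin (R : realType) (T : finType) (P : pred T) (F : T -> R) : R :=
  if [pick x | P x] is Some x0 then F [arg min_(x < x0 | P x) F x]%O else 0.

Lemma fminP (R : realType) (T : finType) (P : pred T) (F : T -> R) :
  (exists x, P x) ->
  (exists2 x, P x & fmin P F = F x) /\ (forall y, P y -> fmin P F <= F y).
Proof.
move=> [x Px]; rewrite /fmin; case: pickP => [x0 Px0|/(_ x)]; last by rewrite Px.
by case: arg_minP => // y Py ymin; split=> //; exists y.
Qed.

(* A weight on pairs is encoded as a symmetric function with zero diagonal,
   i.e. as the weighted adjacency matrix indexed by the vertex set. *)
Definition nonneg_wgraph (R : realType) (V : finType) (w : V -> V -> R) : Prop :=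
  [/\ forall u v, w u v = w v u, forall u, w u u = 0 & forall u v, 0 <= w u v].

Definition wdegree (R : realType) (V : finType) (w : V -> V -> R) (u : V) : R :=
  \sum_v w u v.

(* B_H as a library matrix, the vertices being listed by the enumeration of V. *)
Definition wadj (R : realType) (V : finType) (w : V -> V -> R) : 'M[R]_#|V| :=
  \matrix_(i, j) w (enum_val i) (enum_val j).

Definition total_weight (R : realType) (V : finType) (w : V -> V -> R) : R :=
  \sum_(i < #|V|) \sum_(j < #|V| | (i < j)%N) wadj w i j.

Definition relabel (R : realType) (V : finType) (w : V -> V -> R)
    (p : {ffun 'I_#|V| -> V}) : 'M[R]_#|V| :=
  \matrix_(x, y) w (p x) (p y).

Definition expi (R : realType) (t : R) : R[i] := Complex (cos t) (sin t).

(* Z_N is represented by 'I_N; the entries only depend on r * x modulo N. *)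
Definition fourier (R : realType) (N : nat) : 'M[R[i]]_N :=
  \matrix_(r, x) (((Num.sqrt N%:R)^-1)%:C%C *
                  expi (- (2 * pi * r%:R * x%:R / N%:R))).

Definition norm1 (R : realType) (m n : nat) (C : 'M[R[i]]_(m, n)) : R :=
  \sum_r \sum_v Normc.normc (C r v).

Definition norm2 (R : realType) (m n : nat) (C : 'M[R]_(m, n)) : R :=
  Num.sqrt (\sum_r \sum_v `|C r v| ^+ 2).

Definition Phi (R : realType) (V : finType) (w : V -> V -> R) : R :=
  fmin (fun p : {ffun 'I_#|V| -> V} => `[< bijective p >])
    (fun p => norm1 (fourier R #|V| *m map_mx (real_complex R) (relabel w p)
                     *m fourier R #|V|)).

(* The apex of the cone is [None]. *)
Definition cone (R : realType) (V : finType) (w : V -> V -> R) (M : R) :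
    option V -> option V -> R :=
  fun x y => match x, y with
  | Some u, Some v => w u v
  | None, None => 0
  | _, _ => M
  end.

Definition fpf_involution (V : finType) (tau : {perm V}) : bool :=
  (tau ^+ 2 == 1)%g && [forall v, tau v != v].

Definition perm_matrix (R : realType) (V : finType) (tau : {perm V}) :
    'M[R]_#|V| :=
  \matrix_(i, j) (tau (enum_val i) == enum_val j)%:R.

Definition inv_defect (R : realType) (V : finType) (w : V -> V -> R) : R :=
  fmin (@fpf_involution V)
    (fun tau => 4^-1 * norm2 (wadj w - perm_matrix R tau *m wadj w
                                       *m perm_matrix R tau) ^+ 2).

(* Main.v *)
Require Import Defs.
From HB Require Import structures.
From mathcomp Require Import all_boot all_order all_algebra all_fingroup.
From mathcomp Require Import complex.
From mathcomp Require Import all_classical all_reals all_analysis.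
From mathcomp Require Import ring lra zify.

Set Implicit Arguments.
Unset Strict Implicit.
Unset Printing Implicit Defensive.

Import Order.TTheory GRing.Theory Num.Theory.
Import numFieldNormedType.Exports.

Local Open Scope classical_set_scope.
Local Open Scope ring_scope.

(* Translating a labeling multiplies each Fourier coefficient by a phase, so the
   apex may be put at 0.  With N = n + 1 and b the transform of the weights of
   H, the coefficients of the cone (scaled by N) are then real and nonnegative
   on the two axes, because H is regular, and equal to b - 2M off the axes.
   There |b - 2M| exceeds 2M - Re b by between (Im b)^2 / (4 (M + s)) and
   (Im b)^2 / (4 (M - s)), the linear terms sum to 4 M n^2 - 4 s whatever the
   labeling, and by Parseval the sum of (Im b)^2 is N^2 / 4 times the squared
   distance from the weights to their reflection under x -> - x.  As N is odd,
   this reflection is a fixed-point-free involution of the vertices of H, and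
   every such involution arises from some labeling. *)

(** * Characters of Z_N, with N = m + 2 *)

Lemma expiD (R : realType) (a b : R) : expi (a + b) = expi a * expi b.
Proof. by rewrite /expi cosD sinD; congr Complex; ring. Qed.

Lemma expiN (R : realType) (a : R) : expi (- a) = (expi a)^*%C.
Proof. by rewrite /expi cosN sinN. Qed.

Lemma normc_expi (R : realType) (a : R) : Normc.normc (expi a) = 1.
Proof. by rewrite /Normc.normc /= cos2Dsin2 sqrtr1. Qed.

(** The shape [m.+2] makes the labels a ring, so that arguments of characters are added and
    multiplied modulo N. *)
Definition chi (R : realType) (m : nat) (k : 'I_m.+2) : R[i] :=
  expi (- (2 * pi * k%:R / m.+2%:R)).

Lemma expi_mod (R : realType) (m k : nat) :
  expi (- (2 * pi * k%:R / m.+2%:R)) = chi R (inZp k : 'I_m.+2).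
Proof.
have N0 : m.+2%:R != 0 :> R by rewrite pnatr_eq0.
rewrite /chi /= {1}(divn_eq k m.+2) natrD natrM.
have -> : - (2 * pi * ((k %/ m.+2)%:R * m.+2%:R + (k %% m.+2)%:R) / m.+2%:R) =
  - (2 * pi * (k %% m.+2)%:R / m.+2%:R) - pi *+ 2 *+ (k %/ m.+2) :> R.
  by rewrite -mulr_natr -(mulr_natr pi); field.
rewrite expiD [X in _ * X]expiN.
suff -> : expi (pi *+ 2 *+ (k %/ m.+2)) = 1 :> R[i] by rewrite conjc1 mulr1.
elim: (k %/ m.+2)%N => [|q IH]; first by rewrite mulr0n /expi cos0 sin0.
by rewrite mulrS expiD IH mulr1 /expi cos2pi mulr2n sinDpi sinpi oppr0.
Qed.

Lemma chiD (R : realType) (m : nat) (a b : 'I_m.+2) :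
  chi R (a + b) = chi R a * chi R b.
Proof.
rewrite -expiD -opprD -mulrDl -mulrDr -natrD.
by rewrite expi_mod; congr chi; apply/val_inj.
Qed.

Lemma chi0 (R : realType) (m : nat) : chi R (0 : 'I_m.+2) = 1.
Proof. by rewrite /chi mulr0 mul0r oppr0 /expi cos0 sin0. Qed.

Lemma normc_chi (R : realType) (m : nat) (a : 'I_m.+2) :
  Normc.normc (chi R a) = 1.
Proof. exact: normc_expi. Qed.

Lemma chiN (R : realType) (m : nat) (a : 'I_m.+2) :
  chi R (- a) = (chi R a)^*%C.
Proof.
have h : chi R a * (chi R a)^*%C = 1.
  by rewrite /chi -expiN -expiD subrr /expi cos0 sin0.
by rewrite -[LHS]mulr1 -h mulrA -chiD addNr chi0 mul1r.
Qed.

(** With t = pi a / N in (0, pi), the real part is cos 2t, which is less than 1 because sin t >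
    0. *)
Lemma chi_neq1 (R : realType) (m : nat) (a : 'I_m.+2) :
  a != 0 -> chi R a != 1.
Proof.
move=> a0; have a_gt0 : (0 < a)%N by rewrite lt0n.
have N0 : 0 < m.+2%:R :> R by rewrite ltr0n.
apply/eqP => /(congr1 (@complex.Re R)) /=.
set t : R := pi * (a%:R / m.+2%:R).
have -> : - (2 * pi * a%:R / m.+2%:R) = - (t *+ 2) :> R.
  by rewrite -mulr_natr /t; field.
rewrite cosN cos_mulr2n => h.
have : 0 < sin t.
  apply: sin_gt0_pi; rewrite mulr_gt0 ?pi_gt0 ?divr_gt0 ?ltr0n //=.
  by rewrite gtr_pMr ?pi_gt0 // ltr_pdivrMr // mul1r ltr_nat.
have := cos2Dsin2 t; rewrite -mulr_natr in h; nra.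
Qed.

(** * Fourier transform on Z_N x Z_N *)

Definition dot (m : nat) (k z : 'I_m.+2 * 'I_m.+2) : 'I_m.+2 :=
  k.1 * z.1 + k.2 * z.2.

Definition hat (R : realType) (m : nat) (f : 'I_m.+2 * 'I_m.+2 -> R)
    (k : 'I_m.+2 * 'I_m.+2) : R[i] :=
  \sum_z chi R (dot k z) * (f z)%:C%C.

(** Shifting the index by 1 multiplies the sum by [chi R x], which differs from 1 unless x = 0. *)
Lemma sum_chi (R : realType) (m : nat) (x : 'I_m.+2) :
  \sum_k chi R (k * x) = (m.+2 * (x == 0))%:R.
Proof.
have [->|x0] := eqVneq x 0.
  under eq_bigr do rewrite mulr0 chi0.
  by rewrite sumr_const card_ord muln1.
rewrite muln0; apply/eqP.
rewrite -[_ == _]orFb -(negbTE (chi_neq1 R x0)) -subr_eq0 -mulf_eq0.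
rewrite mulrBl mul1r subr_eq0 big_distrr /=; apply/eqP.
rewrite [RHS](reindex_inj (addrI 1)) /=; apply: eq_bigr => k _.
by rewrite mulrDl mul1r chiD.
Qed.

Lemma sum_chi_dot (R : realType) (m : nat) (z : 'I_m.+2 * 'I_m.+2) :
  \sum_k chi R (dot k z) = ((m.+2 ^ 2) * (z == 0))%:R.
Proof.
under eq_bigr do rewrite /dot chiD.
rewrite -(pair_bigA _ (fun a b => chi R (a * z.1) * chi R (b * z.2))) /=.
rewrite -big_distrlr /= !sum_chi -natrM mulnACA mulnn mulnb.
by case: z.
Qed.

Lemma dotD (m : nat) (k y z : 'I_m.+2 * 'I_m.+2) :
  dot k (y + z) = dot k y + dot k z.
Proof. by rewrite /dot /= !mulrDr addrACA. Qed.

Lemma dotN (m : nat) (k z : 'I_m.+2 * 'I_m.+2) : dot k (- z) = - dot k z.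
Proof. by rewrite /dot /= !mulrN opprD. Qed.

(** Neither factor is conjugated, so orthogonality pairs z with - z. *)
Lemma parseval (R : realType) (m : nat) (f g : 'I_m.+2 * 'I_m.+2 -> R) :
  \sum_k hat f k * hat g k = (m.+2%:R ^+ 2 * \sum_z f z * g (- z))%:C%C.
Proof.
transitivity (\sum_z \sum_y (f z * g y)%:C%C * \sum_k chi R (dot k (z + y))).
  rewrite /hat; under eq_bigr do rewrite big_distrlr /=.
  rewrite exchange_big /=; apply: eq_bigr => z _.
  rewrite exchange_big /=; apply: eq_bigr => y _.
  rewrite big_distrr /=; apply: eq_bigr => k _.
  by rewrite dotD chiD rmorphM /=; ring.
rewrite big_distrr rmorph_sum /=; apply: eq_bigr => z _.
rewrite (bigD1 (- z)) //= [X in _ + X]big1 ?addr0 => [|y /negbTE yz].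
  by rewrite subrr sum_chi_dot eqxx muln1 mulrC !rmorphM /= natrX rmorph_nat.
by rewrite sum_chi_dot addrC addr_eq0 yz muln0 mulr0.
Qed.

Lemma hat_opp (R : realType) (m : nat) (f : 'I_m.+2 * 'I_m.+2 -> R) k :
  hat (f \o -%R) k = (hat f k)^*%C.
Proof.
rewrite /hat rmorph_sum (reindex_inj (@oppr_inj ('I_m.+2 * 'I_m.+2)%type)).
apply: eq_bigr => z _.
have fz : (f \o -%R) (- z) = f z by rewrite -[in RHS](opprK z).
by rewrite dotN chiN fz [RHS]rmorphM; congr (_ * _); rewrite [RHS]conjc_real.
Qed.

(** Translation costs only a phase; this is what allows the apex to be moved to label 0. *)
Lemma hat_shift (R : realType) (m : nat) (f : 'I_m.+2 * 'I_m.+2 -> R) q k :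
  Normc.normc (hat (fun z => f (z + q)) k) = Normc.normc (hat f k).
Proof.
have -> : hat f k = chi R (dot k q) * hat (fun z => f (z + q)) k.
  rewrite /hat (reindex_inj (addIr q)) big_distrr /=; apply: eq_bigr => z _.
  by rewrite dotD chiD; ring.
by rewrite Normc.normcM normc_chi mul1r.
Qed.

Lemma sum_hat (R : realType) (m : nat) (f : 'I_m.+2 * 'I_m.+2 -> R) :
  \sum_k hat f k = (m.+2%:R ^+ 2 * f 0)%:C%C.
Proof.
rewrite /hat exchange_big (bigD1 (0 : 'I_m.+2 * 'I_m.+2)) //=.
rewrite [X in _ + X]big1 ?addr0 => [|z /negbTE z0].
  rewrite -big_distrl /= sum_chi_dot eqxx muln1.
  by rewrite rmorphM /= natrX rmorphXn /= rmorph_nat.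
by rewrite -big_distrl /= sum_chi_dot z0 muln0 mul0r.
Qed.

(** * Estimates of moduli and imaginary parts *)

Lemma normc_sum (R : realType) (I : finType) (F : I -> R[i]) :
  Normc.normc (\sum_i F i) <= \sum_i Normc.normc (F i).
Proof.
elim/big_ind2: _ => [|x a y b hx hy|//]; first by rewrite Normc.normc0.
exact: le_trans (le_normcD _ _) (lerD hx hy).
Qed.

Lemma normc_ge_ReN (R : realType) (x : R[i]) : - complex.Re x <= Normc.normc x.
Proof.
case: x => a b /=; apply: le_trans (ler_norm _) _; rewrite normrN -sqrtr_sqr.
by rewrite ler_wsqrtr // lerDl sqr_ge0.
Qed.

Lemma normc_ge_Re (R : realType) (x : R[i]) : complex.Re x <= Normc.normc x.
Proof.
case: x => a b /=; apply: le_trans (ler_norm _) _; rewrite -sqrtr_sqr.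
by rewrite ler_wsqrtr // lerDl sqr_ge0.
Qed.

Lemma normc_hat (R : realType) (m : nat) (f : 'I_m.+2 * 'I_m.+2 -> R) k :
  (forall z, 0 <= f z) -> Normc.normc (hat f k) <= \sum_z f z.
Proof.
move=> f0; apply: le_trans (normc_sum _) _; apply: ler_sum => z _.
rewrite Normc.normcM normc_chi mul1r /= expr0n addr0 sqrtr_sqr.
by rewrite ger0_norm.
Qed.

(* [4 (Im z)^2 = 2 |z|^2 - z^2 - (z^* )^2], and conjugating [hat f k] reflects
   [f] about the origin. *)
Lemma sum_Im_hat (R : realType) (m : nat) (f : 'I_m.+2 * 'I_m.+2 -> R) :
  \sum_k complex.Im (hat f k) ^+ 2 =
  m.+2%:R ^+ 2 / 4 * \sum_z (f z - f (- z)) ^+ 2.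
Proof.
apply: complexI; rewrite rmorph_sum /=.
have -> : m.+2%:R ^+ 2 / 4 * \sum_(z : 'I_m.+2 * 'I_m.+2) (f z - f (- z)) ^+ 2 =
  4^-1 * ((m.+2%:R ^+ 2 * \sum_(z : 'I_m.+2 * 'I_m.+2) f z * f (- - z)) *+ 2
   - (m.+2%:R ^+ 2 * \sum_(z : 'I_m.+2 * 'I_m.+2) f z * f (- z))
   - m.+2%:R ^+ 2 * \sum_(z : 'I_m.+2 * 'I_m.+2) f (- z) * f (- - z)).
  rewrite -mulrnAr -!mulrBr mulrA (mulrC 4^-1); congr (_ * _).
  have -> : \sum_(z : 'I_m.+2 * 'I_m.+2) (f z - f (- z)) ^+ 2 =
     \sum_(z : 'I_m.+2 * 'I_m.+2) (f z ^+ 2 - f z * f (- z))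
     + \sum_(z : 'I_m.+2 * 'I_m.+2) (f (- z) ^+ 2 - f (- z) * f z).
    by rewrite -big_split; apply: eq_bigr => z _ /=; ring.
  rewrite [X in _ + X](reindex_inj (@oppr_inj ('I_m.+2 * 'I_m.+2)%type)).
  rewrite -sumrMnl -!sumrB -big_split /=.
  by apply: eq_bigr => z _; rewrite opprK; ring.
rewrite rmorphM !rmorphB rmorphMn /= -!parseval.
have := parseval f (f \o -%R); rewrite /= => <-.
have := parseval (f \o -%R) (f \o -%R); rewrite /= => <-.
rewrite -sumrMnl -!sumrB big_distrr /=; apply: eq_bigr => k _; rewrite hat_opp.
case: (hat f k) => a b; rewrite !mulr2n.
by apply/eqP; rewrite eq_complex /=; apply/andP; split; apply/eqP; field.
Qed.

(** With t the square root, t - a = q^2 / (t + a), and 2 lo <= t + a <= 2 hi. *)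
Lemma sqrt_gap (R : realType) (a q lo hi : R) :
  0 < lo -> lo <= a -> Num.sqrt (a ^+ 2 + q ^+ 2) <= hi ->
  q ^+ 2 / (2 * hi) <= Num.sqrt (a ^+ 2 + q ^+ 2) - a <= q ^+ 2 / (2 * lo).
Proof.
move=> lo0 loa; set t := Num.sqrt _ => thi.
have tE : t ^+ 2 = a ^+ 2 + q ^+ 2 by rewrite sqr_sqrtr // addr_ge0 ?sqr_ge0.
have at_ : a <= t.
  rewrite -(ger0_norm (_ : 0 <= a)); last lra.
  by rewrite -sqrtr_sqr ler_wsqrtr // lerDl sqr_ge0.
by rewrite ler_pdivrMr ?ler_pdivlMr; [apply/andP; split; nra | lra | lra].
Qed.

Lemma sum_pair (R : nmodType) (I J : finType) (F : I * J -> R) :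
  \sum_z F z = \sum_x \sum_y F (x, y).
Proof. by rewrite pair_bigA; apply: eq_bigr => -[]. Qed.

Lemma hat_sym (R : realType) (m : nat) (f : 'I_m.+2 * 'I_m.+2 -> R) k :
  (forall x y, f (x, y) = f (y, x)) -> hat f k = hat f (k.2, k.1).
Proof.
move=> fs; rewrite /hat sum_pair.
rewrite exchange_big [RHS]sum_pair.
apply: eq_bigr => x _; apply: eq_bigr => y _.
by rewrite fs /dot /= addrC.
Qed.

(** On this axis the phase ignores x, so only the column sums matter. *)
Lemma hat_axis (R : realType) (m : nat) (f : 'I_m.+2 * 'I_m.+2 -> R) v :
  hat f (0, v) = \sum_y chi R (v * y) * (\sum_x f (x, y))%:C%C.
Proof.
rewrite /hat sum_pair.
rewrite exchange_big /=; apply: eq_bigr => y _.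
rewrite rmorph_sum mulr_sumr; apply: eq_bigr => x _.
by rewrite /dot /= mul0r add0r.
Qed.

(** * The transform of a cone whose apex has label 0 *)

Section Cone.
(** [beta] holds the weights of H, extended by zero to the apex 0; the other m + 1 = n labels are
    the vertices of H, of common degree d, and s is half the sum of the degrees. *)
Variables (R : realType) (m : nat) (beta : 'I_m.+2 * 'I_m.+2 -> R) (d M : R).
Hypotheses (beta_ge0 : forall z, 0 <= beta z) (beta0 : beta 0 = 0)
  (beta_sym : forall x y, beta (x, y) = beta (y, x))
  (beta_col : forall y, \sum_x beta (x, y) = d * (y != 0)%:R).
Let s := m.+1%:R * d / 2.
Hypotheses (m_ge2 : (2 <= m)%N) (sM : s < M).

(* By inclusion-exclusion the factor of [M] is 1 exactly when one coordinate is
   the apex 0 and the other is not. *)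
Definition coned (z : 'I_m.+2 * 'I_m.+2) : R :=
  beta z + M * ((z.1 == 0)%:R + (z.2 == 0)%:R - 2 * (z == 0)%:R).

Let d_ge0 : 0 <= d.
Proof.
have := beta_col 1; rewrite mulr1 => <-.
by apply: sumr_ge0.
Qed.

Let s_ge0 : 0 <= s.
Proof. by rewrite divr_ge0 // mulr_ge0. Qed.

Let n_ge3 : 3 <= m.+1%:R :> R.
Proof. by rewrite (ler_nat R 3). Qed.

Let nE : m.+1%:R = m%:R + 1 :> R.
Proof. by rewrite natr1. Qed.

Let NE : m.+2%:R = m%:R + 2 :> R.
Proof. by rewrite -natr1 nE; ring. Qed.

Lemma coned_sym x y : coned (x, y) = coned (y, x).
Proof.
rewrite /coned beta_sym /= [(x == 0)%:R + _]addrC.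
congr (_ + _ * (_ - 2 * _%:R)).
by rewrite !xpair_eqE andbC.
Qed.

Lemma coned_col y :
  \sum_x coned (x, y) = (M + d) + (m%:R * M - d) * (y == 0)%:R.
Proof.
rewrite big_split /= beta_col -big_distrr /= !big_split /= sumr_const card_ord.
rewrite sumrN -mulr_sumr.
have -> : \sum_(i < m.+2) (i == 0)%:R = 1 :> R.
  by rewrite (bigD1 0) //= big1 ?addr0 // => i /negbTE ->.
have -> : \sum_(i < m.+2) ((i, y) == 0)%:R = (y == 0)%:R :> R.
  rewrite (bigD1 0) //= big1 ?addr0 // => i /negbTE i0.
  by rewrite xpair_eqE i0.
by case: eqP => _; rewrite -[X in M * (_ + X - _)]mulr_natr NE /=; ring.
Qed.

Lemma sum_beta : \sum_z beta z = 2 * s.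
Proof.
rewrite sum_pair exchange_big /=.
under eq_bigr do rewrite beta_col.
rewrite -mulr_sumr (bigD1 0) //= add0r.
rewrite (eq_bigr (fun=> 1)) => [|i ->//].
by rewrite sumr_const cardC1 card_ord /= /s; field.
Qed.

(** By regularity the column sums are constant away from the apex. The constant transforms to a mass
    at v = 0, and the excess at the apex to a constant. *)
Lemma hat_coned_axis v :
  hat coned (0, v) =
  ((M + d) * m.+2%:R * (v == 0)%:R + (m%:R * M - d))%:C%C.
Proof.
rewrite hat_axis; under eq_bigr do rewrite coned_col rmorphD mulrDr /=.
rewrite big_split /= -mulr_suml.
have -> : \sum_y chi R (v * y) = (m.+2 * (v == 0))%:R.
  by rewrite -sum_chi; apply: eq_bigr => y _; rewrite mulrC.
rewrite (bigD1 0) //= big1 ?addr0 => [|y /negbTE ->]; last first.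
  by rewrite mulr0 rmorph0 mulr0.
by rewrite natrM mulr0 chi0 mul1r mulr1; ring.
Qed.
(** The indicator of each axis transforms to N times that of the other axis, and the indicator of
    the origin to 1. *)
Lemma hat_coned k :
  hat coned k = hat beta k +
    (M * (m.+2%:R * (k.1 == 0)%:R + m.+2%:R * (k.2 == 0)%:R - 2))%:C%C.
Proof.
have axis1 : \sum_z chi R (dot k z) * (z.1 == 0)%:R%:C%C
    = (m.+2%:R * (k.2 == 0)%:R)%:C%C.
  rewrite sum_pair.
  rewrite (bigD1 0) //= [X in _ + X]big1 ?addr0 => [|x /negbTE ->]; last first.
    by rewrite big1 // => y _; rewrite mulr0.
  rewrite rmorphM /= !rmorph_nat -natrM -sum_chi; apply: eq_bigr => y _.
  by rewrite mulr1 /dot /= mulr0 add0r mulrC.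
have axis2 : \sum_z chi R (dot k z) * (z.2 == 0)%:R%:C%C
    = (m.+2%:R * (k.1 == 0)%:R)%:C%C.
  rewrite sum_pair.
  rewrite exchange_big /= (bigD1 0) //= [X in _ + X]big1 ?addr0; last first.
    by move=> x /negbTE ->; rewrite big1 // => y _; rewrite mulr0.
  rewrite rmorphM /= !rmorph_nat -natrM -sum_chi; apply: eq_bigr => y _.
  by rewrite mulr1 /dot /= mulr0 addr0 mulrC.
have origin : \sum_z chi R (dot k z) * (z == 0)%:R%:C%C = 1.
  rewrite (bigD1 (0 : 'I_m.+2 * 'I_m.+2)) //= [X in _ + X]big1.
    by rewrite addr0 mulr1 /dot /= !mulr0 addr0 chi0.
  by move=> z /negbTE ->; rewrite mulr0.
transitivity (hat beta k + M%:C%C *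
  (\sum_z chi R (dot k z) * (z.1 == 0)%:R%:C%C
   + \sum_z chi R (dot k z) * (z.2 == 0)%:R%:C%C
   - 2 * \sum_z chi R (dot k z) * (z == 0)%:R%:C%C)).
  rewrite !mulr_sumr -big_split -sumrB mulr_sumr -big_split /=.
  apply: eq_bigr => z _; rewrite /coned !(rmorphD, rmorphN, rmorphM) /=.
  by rewrite rmorph_nat; ring.
rewrite axis1 axis2 origin !(rmorphD, rmorphN, rmorphM) /= !rmorph_nat; ring.
Qed.

Lemma Im_hat_coned k : complex.Im (hat coned k) = complex.Im (hat beta k).
Proof. by rewrite hat_coned; case: (hat beta k) => a b /=; rewrite addr0. Qed.

Let on_axes (k : 'I_m.+2 * 'I_m.+2) := (k.1 == 0) || (k.2 == 0).

Lemma hat_coned_on_axes k : on_axes k ->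
  complex.Im (hat coned k) = 0 /\ 0 <= complex.Re (hat coned k).
Proof.
(* The symmetry of [coned] exchanges the two axes. *)
wlog k1 : k / k.1 = 0 => [th|_].
  case/orP => k0; first by apply: th; rewrite /on_axes ?k0 //; apply/eqP.
  rewrite (hat_sym _ coned_sym).
  by apply: th; rewrite /on_axes /= ?k0 //; apply/eqP.
case: k k1 => _ v /= ->; rewrite hat_coned_axis /=; split => //.
have M_ge0 : 0 <= M by apply: le_trans s_ge0 (ltW sM).
apply: addr_ge0; first by rewrite !mulr_ge0 // addr_ge0.
(* As n >= 3, d <= n d / 2 = s < M. *)
have dM : d <= M.
  by apply: le_trans (ltW sM); move: n_ge3; rewrite /s; move: d_ge0; nra.
have m_ge1 : 1 <= m%:R :> R by rewrite (ler_nat R 1) ltnW.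
by nra.
Qed.

Lemma hat_coned_off_axes k : ~~ on_axes k ->
  complex.Im (hat beta k) ^+ 2 / (4 * (M + s))
    <= Normc.normc (hat coned k) + complex.Re (hat coned k)
    <= complex.Im (hat beta k) ^+ 2 / (4 * (M - s)).
Proof.
rewrite negb_or => /andP[/negbTE k1 /negbTE k2].
have := hat_coned k; rewrite k1 k2 !mulr0 add0r => ->.
have := normc_hat k beta_ge0; rewrite sum_beta.
have := normc_ge_ReN (hat beta k); have := normc_ge_Re (hat beta k).
case: (hat beta k) => a b /= h1 h2 h3.
have -> : a + M * (0 - 2) = - (2 * M - a) by ring.
rewrite addr0 sqrrN.
(* [sqrt_gap] is applied at 2 M - a: since [hat beta k] has modulus at most 2 s, this is at least lo
   = 2 M - 2 s and the modulus of the coefficient is at most hi = 2 M + 2 s. *)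
have -> : 4 * (M + s) = 2 * (2 * M + 2 * s) by ring.
have -> : 4 * (M - s) = 2 * (2 * M - 2 * s) by ring.
have sM' := sM; apply: sqrt_gap; [lra|lra|].
have h4 : a ^+ 2 + b ^+ 2 <= (2 * s) ^+ 2.
  rewrite -(@sqr_sqrtr _ (a ^+ 2 + b ^+ 2)) ?addr_ge0 ?sqr_ge0 //.
  by rewrite ler_sqr ?nnegrE ?sqrtr_ge0 //; lra.
rewrite -(@ger0_norm _ (2 * M + 2 * s)); last lra.
by rewrite -sqrtr_sqr ler_wsqrtr //; nra.
Qed.

Lemma sum_on_axes : \sum_(k | on_axes k) complex.Re (hat coned k) =
  2 * M * m.+1%:R ^+ 2 - 2 * s.
Proof.
pose F x y := complex.Re (hat coned (x, y)).
have F0 v : F 0 v = (M + d) * m.+2%:R * (v == 0)%:R + (m%:R * M - d).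
  by rewrite /F hat_coned_axis.
have Fsym x : F x 0 = F 0 x by rewrite /F (hat_sym _ coned_sym).
(* Both axes are added, and the origin, counted twice, is removed once. *)
transitivity (\sum_y F 0 y + \sum_x F x 0 - F 0 0).
  rewrite big_mkcond sum_pair.
  rewrite (bigD1 0) //=.
  have -> : \sum_x F x 0 = F 0 0 + \sum_(x | x != 0) F x 0 by rewrite (bigD1 0).
  rewrite -addrA [X in _ = _ + X]addrAC subrr add0r; congr (_ + _).
  apply: eq_bigr => x /negbTE x0; rewrite (bigD1 0) //= {1}/on_axes eqxx orbT.
  by rewrite big1 ?addr0 // => y /negbTE y0; rewrite /on_axes /= x0 y0.
under [X in _ + X - _]eq_bigr do rewrite Fsym.
have -> : \sum_y F 0 y = m.+2%:R * m.+1%:R * M.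
  under eq_bigr do rewrite F0.
  rewrite big_split -mulr_sumr /= sumr_const card_ord (bigD1 0) //= big1.
    by rewrite -mulr_natr NE nE; ring.
  by move=> y /negbTE ->.
by rewrite F0 eqxx mulr1n /s NE nE; field.
Qed.

Lemma norm_hat_coned (Q : R) :
  Q = \sum_k complex.Im (hat beta k) ^+ 2 ->
  Q / (4 * (M + s))
   <= \sum_k Normc.normc (hat coned k) - (4 * M * m.+1%:R ^+ 2 - 4 * s)
   <= Q / (4 * (M - s)).
Proof.
move=> ->.
(* The coefficients sum to N^2 times the entry at the origin, the zero diagonal entry of the
   apex. *)
have total : \sum_k complex.Re (hat coned k) = 0.
  rewrite -(raddf_sum (@complex.Re R : Rcomplex R -> R)).
  have -> : \sum_k (hat coned k : Rcomplex R) = \sum_k hat coned k by [].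
  by rewrite sum_hat /coned beta0 /=; ring.
(* Real parts may be added everywhere, as their total is 0, and the subtracted constant is twice
   their sum over the axes. Each axis term then vanishes, and each other term is the gap already
   bounded. *)
have -> : \sum_k Normc.normc (hat coned k) - (4 * M * m.+1%:R ^+ 2 - 4 * s) =
  \sum_k (Normc.normc (hat coned k) + complex.Re (hat coned k)
    - (if on_axes k then 2 * complex.Re (hat coned k) else 0)).
  rewrite sumrB big_split /= total -big_mkcond -mulr_sumr sum_on_axes; ring.
rewrite !mulr_suml; apply/andP; split; apply: ler_sum => k _.
- case: ifP => [/hat_coned_on_axes|/negbT /hat_coned_off_axes /andP[h _]].
    rewrite -Im_hat_coned => -[-> Re0]; rewrite expr0n mul0r.
    by have := normc_ge_Re (hat coned k); lra.
  by rewrite subr0.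
- case: ifP => [/hat_coned_on_axes|/negbT /hat_coned_off_axes /andP[_ h]].
    rewrite -Im_hat_coned; case: (hat coned k) => a b /= [-> a0].
    by rewrite expr0n mul0r addr0 sqrtr_sqr ger0_norm //; lra.
  by rewrite subr0.
Qed.
End Cone.

(** * Labelings, their costs and the defect of an involution *)

Lemma norm1_fourier (R : realType) (m : nat) (A : 'M[R]_m.+2) :
  Defs.norm1 (fourier R m.+2 *m map_mx (real_complex R) A *m fourier R m.+2) =
  m.+2%:R^-1 * \sum_k Normc.normc (hat (fun z => A z.1 z.2) k).
Proof.
have fourierE (r x : 'I_m.+2) :
    fourier R m.+2 r x = ((Num.sqrt m.+2%:R)^-1)%:C%C * chi R (r * x).
  by rewrite mxE -(mulrA (2 * pi)) -natrM expi_mod.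
rewrite /Defs.norm1 pair_bigA mulr_sumr /=; apply: eq_bigr => -[r v] _ /=.
have -> : m.+2%:R^-1 = Normc.normc ((m.+2%:R^-1 : R)%:C%C).
  by rewrite /= expr0n addr0 sqrtr_sqr ger0_norm // invr_ge0.
rewrite -Normc.normcM; congr Normc.normc.
rewrite mxE; under eq_bigr do rewrite mxE mulr_suml.
rewrite exchange_big pair_bigA mulr_sumr /=; apply: eq_bigr => -[x y] _ /=.
have cc : m.+2%:R^-1 = (Num.sqrt m.+2%:R)^-1 * (Num.sqrt m.+2%:R)^-1 :> R.
  by rewrite -invfM -expr2 sqr_sqrtr.
rewrite !fourierE mxE /dot /= chiD [y * v]mulrC cc rmorphM /=.
ring.
Qed.

Lemma big_option (R : nmodType) (V : finType) (F : option V -> R) :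
  \sum_a F a = F None + \sum_u F (Some u).
Proof.
rewrite (bigD1 None) //=; congr (_ + _).
by rewrite (reindex_omap Some id) => [|[]//]; apply: eq_bigl => u; rewrite eqxx.
Qed.

(** Moves the labels from ['I_#|V|] to ['I_N], so that the ring structure on ['I_m.+2] becomes
    available. *)
Lemma Phi_attained (R : realType) (V : finType) (w : V -> V -> R) (N : nat) :
  #|V| = N ->
  let cost (p : 'I_N -> V) := Defs.norm1 (fourier R N *m
    map_mx (real_complex R) (\matrix_(x, y) w (p x) (p y)) *m fourier R N) in
  (exists2 p, bijective p & Phi w = cost p) /\
  (forall p, bijective p -> Phi w <= cost p).
Proof.
case: N / => cost.
have costE (p : {ffun 'I_#|V| -> V}) : Defs.norm1 (fourier R #|V| *m
    map_mx (real_complex R) (relabel w p) *m fourier R #|V|) = cost p by [].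
have [|[p /asboolP bp pE] pmin] := @fminP R {ffun 'I_#|V| -> V}
    (fun p => `[< bijective p >])
    (fun p => Defs.norm1 (fourier R #|V| *m
      map_mx (real_complex R) (relabel w p) *m fourier R #|V|)).
  exists [ffun i => enum_val i]; apply/asboolP.
  apply: (@eq_bij _ _ enum_val); last by move=> i; rewrite ffunE.
  exact: enum_val_bij.
split; first by exists p.
move=> q bq; have <- : cost [ffun x => q x] = cost q.
  rewrite /cost; congr (Defs.norm1 (_ *m map_mx _ _ *m _)).
  by apply/matrixP => x y; rewrite !mxE !ffunE.
rewrite -costE; apply: pmin; apply/asboolP.
by apply: (eq_bij bq) => i; rewrite ffunE.
Qed.

(** Four times the quantity minimized in [inv_defect], summed over vertices instead of matrix
    indices. *)
Definition defect (R : realType) (V : finType) (w : V -> V -> R)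
    (tau : {perm V}) : R := \sum_u \sum_v (w u v - w (tau u) (tau v)) ^+ 2.

Lemma norm2_defect (R : realType) (V : finType) (w : V -> V -> R)
    (tau : {perm V}) : fpf_involution tau ->
  norm2 (wadj w - perm_matrix R tau *m wadj w *m perm_matrix R tau) ^+ 2 =
  defect w tau.
Proof.
case/andP => /eqP tau2 _.
have tauK : involutive tau by move=> u; rewrite -permM -expg2 tau2 perm1.
have PBP i j : (perm_matrix R tau *m wadj w *m perm_matrix R tau) i j =
    w (tau (enum_val i)) (tau (enum_val j)).
  rewrite mxE (bigD1 (enum_rank (tau (enum_val j)))) //=.
  rewrite [X in _ + X]big1 ?addr0 => [|l lj]; last first.
    rewrite [in X in _ * X]mxE (_ : _ == _ = false) ?mulr0 //.
    by apply: contraNF lj => /eqP <-; rewrite tauK enum_valK.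
  rewrite [in X in _ * X]mxE enum_rankK tauK eqxx mulr1 mxE.
  rewrite (bigD1 (enum_rank (tau (enum_val i)))) //= big1 => [|l lj].
    by rewrite !mxE !enum_rankK eqxx mul1r addr0.
  rewrite mxE (_ : _ == _ = false) ?mul0r //.
  by apply: contraNF lj => /eqP ->; rewrite enum_valK.
rewrite /norm2 sqr_sqrtr; last by do 2!apply: sumr_ge0 => ? _; rewrite sqr_ge0.
rewrite [RHS](reindex _ (onW_bij _ (enum_val_bij _))) /=.
apply: eq_bigr => i _; rewrite [RHS](reindex _ (onW_bij _ (enum_val_bij _))) /=.
apply: eq_bigr => j _.
by rewrite mxE [X in _ + X]mxE PBP mxE real_normK ?num_real.
Qed.

Lemma total_weightE (R : realType) (V : finType) (w : V -> V -> R) :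
  nonneg_wgraph w -> 2 * total_weight w = \sum_u wdegree w u.
Proof.
case=> wsym w0 _.
have -> : \sum_u wdegree w u = \sum_i \sum_j wadj w i j.
  rewrite (reindex _ (onW_bij _ (enum_val_bij _))) /=; apply: eq_bigr => i _.
  rewrite /wdegree (reindex _ (onW_bij _ (enum_val_bij _))) /=.
  by apply: eq_bigr => j _; rewrite mxE.
have -> : \sum_i \sum_j wadj w i j = total_weight w +
    \sum_(i < #|V|) \sum_(j < #|V| | (j < i)%N) wadj w i j.
  rewrite -big_split /=; apply: eq_bigr => i _.
  rewrite (bigID (fun j : 'I_#|V| => (i < j)%N)) /=; congr (_ + _).
  rewrite (bigD1 i) ?ltnn //= mxE w0 add0r; apply: eq_bigl => j.
  by rewrite -leqNgt ltn_neqAle andbC.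
rewrite mulr_natl mulr2n; congr (_ + _).
rewrite (exchange_big_dep xpredT) //=; apply: eq_bigr => i _.
by apply: eq_bigr => j _; rewrite !mxE wsym.
Qed.

(** The bounds for a single labeling: the apex has label [q], and [tau] is the reflection of the
    labels about [q], seen on the vertices of H. *)
Lemma label_cost (R : realType) (V : finType) (m : nat) (w : V -> V -> R)
    (M : R) (p : 'I_m.+2 -> option V) (q : 'I_m.+2) (tau : {perm V}) :
  (2 <= m)%N -> #|V| = m.+1 -> nonneg_wgraph w ->
  (forall u v : V, wdegree w u = wdegree w v) -> total_weight w < M ->
  bijective p -> p q = None ->
  (forall x, p (- x + q) = omap tau (p (x + q))) ->
  let s := total_weight w in
  let a := 4^-1 * defect w tau in
  let gap := Defs.norm1 (fourier R m.+2 *m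
    map_mx (real_complex R) (\matrix_(x, y) cone w M (p x) (p y))
      *m fourier R m.+2) - (4 * M * m.+1%:R ^+ 2 - 4 * s) / m.+2%:R in
  m.+2%:R * a / (4 * (M + s)) <= gap /\ gap <= m.+2%:R * a / (4 * (M - s)).
Proof.
move=> m_ge2 cardV hw hreg sM bp pq ptau /=.
have [wsym wdiag w_ge0] := hw.
pose p' x := p (x + q).
have bp' : bijective p'.
  by apply: (bij_comp bp); exists (fun x => x - q) => x; rewrite ?addrK ?subrK.
have p'0 : p' 0 = None by rewrite /p' add0r.
have p'E x : (p' x == None) = (x == 0).
  by rewrite -p'0 (inj_eq (bij_inj bp')).
(* Label 1 is not the apex, so it supplies a vertex from which to read off the common degree. *)
have [u0 _] : exists u0, p' 1 = Some u0.
  by case p1: (p' 1) (p'E 1) => [u|] // _; exists u.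
pose d := wdegree w u0.
have sE : total_weight w = m.+1%:R * d / 2.
  apply: (mulfI (_ : (2 : R) != 0)); first by rewrite pnatr_eq0.
  rewrite total_weightE // (eq_bigr (fun=> d)) => [|u _]; last exact: hreg.
  by rewrite sumr_const cardV -mulr_natl; field.
(* A cone of weight 0 extends the weights of H by zero to the apex. *)
pose beta z := cone w 0 (p' z.1) (p' z.2).
have beta_ge0 z : 0 <= beta z.
  by rewrite /beta /cone; case: (p' z.1) (p' z.2) => [u|] [v|].
have beta0 : beta 0 = 0 by rewrite /beta /= p'0.
have beta_sym x y : beta (x, y) = beta (y, x).
  by rewrite /beta /cone /=; case: (p' x) (p' y) => [u|] [v|].
have beta_col y : \sum_x beta (x, y) = d * (y != 0)%:R.
  rewrite -(p'E y) /beta /=.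
  have -> : \sum_x cone w 0 (p' x) (p' y) = \sum_a cone w 0 a (p' y).
    by rewrite [RHS](reindex _ (onW_bij _ bp')).
  rewrite big_option; case: (p' y) => [v|] /=; last first.
    by rewrite big1 ?mulr0 ?addr0.
  by rewrite add0r mulr1 /d (hreg u0 v); apply: eq_bigr => u _.
rewrite sE in sM *.
have := norm_hat_coned beta_ge0 beta0 beta_sym beta_col m_ge2 sM erefl.
rewrite sum_Im_hat.
(* Negating labels applies [tau] to vertices; pairs containing the apex contribute nothing. *)
have -> : \sum_z (beta z - beta (- z)) ^+ 2 = defect w tau.
  pose G a b := (cone w 0 a b -
    cone w 0 (omap tau a) (omap tau b)) ^+ 2.
  transitivity (\sum_a \sum_b G a b).
    rewrite sum_pair [RHS](reindex _ (onW_bij _ bp')); apply: eq_bigr => x _.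
    rewrite [RHS](reindex _ (onW_bij _ bp')); apply: eq_bigr => y _.
    by rewrite /beta /G /= /p' -!ptau.
  have G0 b : G None b = 0 by case: b => [b|]; rewrite /G /= subrr expr0n.
  rewrite big_option big1 // add0r; apply: eq_bigr => u _.
  by rewrite big_option {1}/G /= subrr expr0n add0r.
(* Shifting both coordinates by [q] undoes the translation without changing any modulus. *)
have -> : \sum_k Normc.normc (hat (coned beta M) k) =
   \sum_k Normc.normc (hat (fun z => cone w M (p z.1) (p z.2)) k).
  apply: eq_bigr => k _; rewrite -[RHS](hat_shift _ (q, q)); congr Normc.normc.
  apply: eq_bigr => -[x y] _; congr (_ * _%:C%C).
  rewrite /coned /beta /= -/(p' x) -/(p' y) xpair_eqE -!p'E.
  by case: (p' x) (p' y) => [u|] [v|] /=; ring.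
rewrite norm1_fourier.
set S1 := \sum_k _; set S2 := \sum_k _; have -> : S2 = S1.
  apply: eq_bigr => k _; congr Normc.normc; apply: eq_bigr => z _.
  by rewrite mxE.
have N_gt0 : 0 < m.+2%:R :> R by rewrite ltr0n.
set X := 4 * M * _ ^+ 2 - _.
have -> : m.+2%:R^-1 * S1 - X / m.+2%:R = (S1 - X) / m.+2%:R by field.
(* Dividing by N turns N^2 / 4 times the defect into N times a quarter of the defect. *)
move=> /andP[lo hi]; rewrite ler_pdivlMr // ler_pdivrMr //; split.
  rewrite [X in X <= _](_ : _ = m.+2%:R ^+ 2 / 4 * defect w tau /
    (4 * (M + m.+1%:R * d / 2))) //.
  by move: ((4 * _)^-1) => I; field.
rewrite [X in _ <= X](_ : _ = m.+2%:R ^+ 2 / 4 * defect w tau /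
  (4 * (M - m.+1%:R * d / 2))) //.
by move: ((4 * _)^-1) => I; field.
Qed.

(** * Correspondence between labelings and fixed-point-free involutions *)

(** Reflecting the labels about [q] fixes only [q], because N is odd; hence it restricts to the
    vertices of H and fixes none of them. *)
Lemma involution_of_labeling (V : finType) (m : nat)
    (p : 'I_m.+2 -> option V) (q : 'I_m.+2) :
  odd m -> bijective p -> p q = None ->
  exists2 tau : {perm V}, fpf_involution tau &
    forall x, p (- x + q) = omap tau (p (x + q)).
Proof.
move=> m_odd [r pK rK] pq.
pose sigma a := p (- (r a - q) + q).
have sigmaK : involutive sigma.
  by move=> a; rewrite /sigma pK addrK opprK subrK rK.
have rN : r None = q by rewrite -pq pK.
have sigmaN : sigma None = None by rewrite /sigma rN subrr oppr0 add0r.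
have sigmaS u : {v | sigma (Some u) = Some v}.
  case E: (sigma (Some u)) => [v|]; first by exists v.
  by have := sigmaK (Some u); rewrite E sigmaN.
pose t u := sval (sigmaS u).
have tE u : sigma (Some u) = Some (t u) by rewrite /t; case: (sigmaS u).
have tK : involutive t.
  by move=> u; apply: Some_inj; rewrite -!tE sigmaK.
exists (perm (inv_inj tK)).
  apply/andP; split.
    by apply/eqP/permP => u; rewrite expg2 permM !permE tK.
  apply/forallP => u; rewrite permE; apply/eqP => tu.
  have := tE u; rewrite tu /sigma => /(congr1 r); rewrite pK.
  set y := r (Some u); have yq : y - q != 0.
    by rewrite subr_eq0 -rN (can_eq rK).
  move/(canRL (addrK q)); move: (y - q) yq => z z0 zz.
  (* A nonzero z equal to - z would satisfy 2 z = N as natural numbers, against the parity of N. *)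
  have : (val z + val z)%N = m.+2.
    have /(congr1 val) /= := zz.
    have z_gt0 : (0 < z)%N by rewrite lt0n.
    rewrite modn_small ?ltn_subrL ?z_gt0 // => h.
    by rewrite -[X in (X + _)%N]h subnK // ltnW.
  by move/(congr1 odd); rewrite /= addnn odd_double m_odd.
move=> x; case E: (p (x + q)) => [u|] /=.
  by rewrite permE -tE /sigma -E pK addrK.
by rewrite -sigmaN /sigma -E pK addrK.
Qed.

(* List one point of each orbit as [1, ..., #|A|]; its partner gets the opposite
   label. *)
Lemma labeling_of_involution (V : finType) (m : nat) (tau : {perm V}) :
  #|V| = m.+1 -> fpf_involution tau ->
  exists p : 'I_m.+2 -> option V, [/\ bijective p, p 0 = None &
    forall x, p (- x) = omap tau (p x)].
Proof.
move=> cardV /andP[/eqP tau2 /forallP tau_fpf].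
have tauK : involutive tau by move=> u; rewrite -permM -expg2 tau2 perm1.
(* The representative of an orbit is its point of smaller rank; [tau] exchanges [A] with its
   complement, having no fixed point. *)
pose A := [set u | (enum_rank u < enum_rank (tau u))%N]%SET.
have AN u : (tau u \in A) = (u \notin A).
  rewrite !inE tauK -leqNgt [RHS]leq_eqVlt.
  case: eqP => [/val_inj/enum_rank_inj h|//].
  by have := tau_fpf u; rewrite h eqxx.
have cardA : (#|A| + #|A| = m.+1)%N.
  rewrite -cardV -(cardsC A); congr (_ + _)%N.
  rewrite -(card_imset _ (@perm_inj _ tau)); apply: eq_card => u.
  rewrite -[u in LHS]tauK (mem_imset _ _ (@perm_inj _ tau)) AN.
  by rewrite finset.in_setC.
pose k u := (index u (enum A)).+1.
have k_le u : u \in A -> (0 < k u <= #|A|)%N.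
  by rewrite -mem_enum -index_mem -cardE.
have k_inj u v : u \in A -> v \in A -> k u = k v -> u = v.
  by rewrite -!(mem_enum A) => uA vA [] /index_inj; apply.
(* The inverse labeling, with 0 kept for the apex; it turns [tau] into negation by construction. *)
pose r a : 'I_m.+2 := if a is Some u then
  if u \in A then inord (k u) else - inord (k (tau u)) else 0.
have rA u : u \in A -> r (Some u) = k u :> nat.
  move=> uA; rewrite /r uA inordK //.
  by case/andP: (k_le u uA); lia.
have rNA u : u \notin A -> r (Some u) = (m.+2 - k (tau u))%N :> nat.
  move=> uA; have := uA; rewrite -AN => /k_le /andP[k1 k2].
  rewrite /r (negbTE uA) /= inordK; last lia.
  by rewrite modn_small //; lia.
have rtau a : r (omap tau a) = - r a.
  case: a => [u|] /=; last by rewrite oppr0.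
  by rewrite AN tauK; case: (u \in A) => /=; rewrite ?opprK.
have r_inj : injective r.
  (* As N = 2 |A| + 1, the labels of [A] and those of its complement lie in disjoint ranges that
     avoid 0. *)
  have key u : (if u \in A then 0 < r (Some u) <= #|A|
      else #|A| < r (Some u) < m.+2)%N.
    case: ifPn => uA; first by rewrite rA // k_le.
    have := uA; rewrite -AN => /k_le; rewrite rNA //; lia.
  move=> [u|] [v|] //.
  - move=> e; have := key u; have := key v; rewrite e.
    have {}e : r (Some u) = r (Some v) :> nat by rewrite e.
    case: ifPn => vA; case: ifPn => uA; [|by lia|by lia|].
      by move: e; rewrite !rA // => /(k_inj _ _ uA vA) ->.
    move: e; rewrite !rNA // => e _ _; congr Some; apply: (@perm_inj _ tau).
    rewrite -!AN in uA vA.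
    by apply: k_inj => //; move: (k_le _ uA) (k_le _ vA); lia.
  - by move=> e; have := key u; rewrite e /=; case: ifP.
  - by move=> e; have := key v; rewrite -e /=; case: ifP.
have [p rK pK] : bijective r.
  by apply: inj_card_bij r_inj _; rewrite card_option cardV card_ord.
exists p; split; first by exists r.
  by rewrite -[0]/(r None) rK.
by move=> x; rewrite -{1}(pK x) -rtau rK.
Qed.

(** * Optimization over labelings, and the limit for large cone weight *)

Theorem theorem4p5 (R : realType) (V : finType) (n : nat) (w : V -> V -> R)
    (hn : #|V| = n) (n_even : ~~ odd n) (n_ge4 : (4 <= n)%N)
    (hw : nonneg_wgraph w)
    (hreg : forall u v : V, wdegree w u = wdegree w v) :
  let s : R := total_weight w in
  let N : R := n.+1%:R in
  let T : R -> R := fun M => (4 * M * n%:R ^+ 2 - 4 * s) / N in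
  (forall M : R, s < M ->
     N * inv_defect w / (4 * (M + s)) <= Phi (cone w M) - T M /\
     Phi (cone w M) - T M <= N * inv_defect w / (4 * (M - s))) /\
  M * (Phi (cone w M) - T M) @[M --> +oo] --> N / 4 * inv_defect w.
Proof.
case: n => // m in hn n_even n_ge4 *; rewrite /= negbK in n_even.
move=> s N T.
have m_ge2 : (2 <= m)%N by rewrite -ltnS ltnW.
have s_ge0 : 0 <= s.
  have [_ _ w_ge0] := hw.
  by do 2!apply: sumr_ge0 => ? _; rewrite mxE.
have cardV' : #|{: option V}| = m.+2 by rewrite card_option hn.
have termE (tau : {perm V}) : fpf_involution tau ->
    4^-1 * norm2 (wadj w - perm_matrix R tau *m wadj w
                             *m perm_matrix R tau) ^+ 2 = 4^-1 * defect w tau.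
  by move=> ftau; rewrite norm2_defect.
have defect_ge0 tau : 0 <= defect w tau.
  by do 2!apply: sumr_ge0 => ? _; rewrite sqr_ge0.
have [[tau0 ftau0 a_tau0] a_min] : (exists2 tau, fpf_involution tau &
    inv_defect w = 4^-1 * defect w tau) /\
    (forall tau, fpf_involution tau -> inv_defect w <= 4^-1 * defect w tau).
  have [|[tau ftau e] h] := @fminP R {perm V} (@fpf_involution V)
    (fun tau => 4^-1 * norm2 (wadj w - perm_matrix R tau *m wadj w
                                       *m perm_matrix R tau) ^+ 2).
    (* Any labeling of the cone yields a fixed-point-free involution, so the minimum in [inv_defect]
       is not the junk value. *)
    have bp : bijective
        (fun i : 'I_m.+2 => enum_val (cast_ord (esym cardV') i)).
      by apply: bij_comp (enum_val_bij _) _; exists (cast_ord cardV') => i;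
        rewrite ?cast_ordK ?cast_ordKV.
    have [r _ rK] := bp.
    have [tau ftau _] := involution_of_labeling n_even bp (rK None).
    by exists tau.
  split; first by exists tau; rewrite // -termE.
  by move=> t ft; rewrite -termE //; apply: h.
have a_ge0 : 0 <= inv_defect w by rewrite a_tau0 mulr_ge0 ?invr_ge0.
have bounds M : s < M ->
     N * inv_defect w / (4 * (M + s)) <= Phi (cone w M) - T M /\
     Phi (cone w M) - T M <= N * inv_defect w / (4 * (M - s)).
  (* The lower bound uses the involution of an optimal labeling; the upper bound uses a labeling
     built from an optimal involution. *)
  move=> sM; have [[p bp ->] Pmin] := Phi_attained (cone w M) cardV'; split.
    have [r _ rK] := bp.
    have [tau ftau ptau] := involution_of_labeling n_even bp (rK None).
    have [lo _] := label_cost m_ge2 hn hw hreg sM bp (rK None) ptau.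
    apply: le_trans lo; rewrite ler_wpM2r ?ler_wpM2l ?a_min //.
    by rewrite invr_ge0; lra.
  have [p' [bp' p'0 ptau]] := labeling_of_involution hn ftau0.
  have ptau0 x : p' (- x + 0) = omap tau0 (p' (x + 0)) by rewrite !addr0.
  have [_ hi] := label_cost m_ge2 hn hw hreg sM bp' p'0 ptau0.
  rewrite a_tau0; apply: le_trans hi; rewrite lerD2r; exact: Pmin.
split=> //.
set K := N / 4 * inv_defect w.
have K_ge0 : 0 <= K by rewrite mulr_ge0 // divr_ge0.
apply/cvgrPdist_le => e e_gt0.
near=> M.
(* With X the gap, the two bounds give |M X - K| <= X s <= K s / (M - s), which is at most e beyond
   this threshold. *)
have sM : s + K * s / e < M by near: M; apply: nbhs_pinfty_gt; rewrite num_real.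
have sM1 : s < M.
  apply: le_lt_trans sM; rewrite lerDl divr_ge0 ?mulr_ge0 //; exact: ltW.
have [lo hi] := bounds M sM1.
have KE x : 0 < x -> N * inv_defect w / (4 * x) = K / x.
  by move=> x0; rewrite /K; field; rewrite gt_eqF.
have Ms_gt0 : 0 < M - s by lra.
have Ms'_gt0 : 0 < M + s by lra.
rewrite KE // in lo; rewrite KE // in hi.
have Kse : K * s <= e * (M - s).
  rewrite [X in _ <= X]mulrC -ler_pdivrMr //; lra.
set X := Phi (cone w M) - T M in lo hi *.
have lo' : K <= X * (M + s) by rewrite -ler_pdivrMr.
have hi' : X * (M - s) <= K by rewrite -ler_pdivlMr.
have X_ge0 : 0 <= X by apply: le_trans lo; rewrite divr_ge0 // ltW.
rewrite ler_distl; apply/andP; split; nra.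
Unshelve. all: by end_near.
Qed.
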